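(* Let $a,b,q\ge1$ be integers, $T\in\mathrm{Inc}^q(a\times b)$, and $1\le i\le q$. The symbol $i$ is a descent of $T$ if and only if $i-1 \bmod q$ (the representative in $\{1,\dots,q\}$, so that $1-1$ is read as $q$) is a descent of $K\text{-}\mathrm{Pro}(T)$.
   Context: **Increasing tableaux.** An increasing tableau of shape $a\times b$ is a filling of the rectangle with $a$ rows and $b$ columns by positive integers that strictly increase from left to right along rows and from top to bottom down columns. $\mathrm{Inc}^q(a\times b)$ is the set of those with all entries at most $q$ (not every integer in $\{1,\dots,q\}$ need appear). **$K$-promotion.** For $T\in\mathrm{Inc}^q(a\times b)$, delete all labels $1$. Then for $i=2,3,\dots,q$ in turn, consider the set of boxes that are currently empty or contain $i$, and decompose it into connected components (adjacency = sharing an edge). In each component with more than one box, simultaneously delete every label $i$ and place $i$ in every box that was empty; leave one-box components unchanged. Finally, fill the remaining empty boxes with $q+1$ and subtract $1$ from every entry. The result is $K\text{-}\mathrm{Pro}(T)\in\mathrm{Inc}^q(a\times b)$. **Descents.** Let $T\in\mathrm{Inc}^q(a\times b)$. For $1\le i<q$, the symbol $i$ is a descent of $T$ if some instance of $i$ in $T$ appears in a (strictly) higher row than some instance of $i+1$. Additionally, $q$ is a descent of $T$ if and only if $q-1$ is a descent of $K\text{-}\mathrm{Pro}(T)$ (for $q=1$, the symbol $0$ is never a descent). *)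

(* Defs.v *)
From mathcomp Require Import all_boot.

Set Implicit Arguments.
Unset Strict Implicit.
Unset Printing Implicit Defensive.

Section Defs.

Variables (a b : nat).

(* (r, c): r counts rows from the top, c counts columns from the left. *)
Definition box := ('I_a * 'I_b)%type.

Definition filling := {ffun box -> nat}.

Definition increasing_tableau (q : nat) (T : filling) : Prop :=
  [/\ forall x, 0 < T x <= q,
      forall (r : 'I_a) (c c' : 'I_b), c < c' -> T (r, c) < T (r, c')
    & forall (r r' : 'I_a) (c : 'I_b), r < r' -> T (r, c) < T (r', c)].

(* [None] marks an empty box. *)
Definition partial_filling := {ffun box -> option nat}.

Definition adjacent (x y : box) : bool :=
  (x.1 == y.1) && ((x.2.+1 == y.2) || (y.2.+1 == x.2))
  || (x.2 == y.2) && ((x.1.+1 == y.1) || (y.1.+1 == x.1)).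

Definition active (i : nat) (F : partial_filling) : {set box} :=
  [set x | (F x == None) || (F x == Some i)].

Definition component (S : {set box}) (x : box) : {set box} :=
  [set y | connect (fun u v => [&& u \in S, v \in S & adjacent u v]) x y].

Definition swap_step (F : partial_filling) (i : nat) : partial_filling :=
  [ffun x => if (x \in active i F) && (1 < #|component (active i F) x|)
             then (if F x == None then Some i else None)
             else F x].

Definition delete_ones (T : filling) : partial_filling :=
  [ffun x => if T x == 1 then None else Some (T x)].

Definition KPro (q : nat) (T : filling) : filling :=
  let F := foldl swap_step (delete_ones T) (index_iota 2 q.+1) in
  [ffun x => (odflt q.+1 (F x)).-1].

Definition low_descent (q : nat) (T : filling) (i : nat) : bool :=
  [&& 0 < i, i < q &
      [exists x : box, [exists y : box,
         [&& T x == i, T y == i.+1 & x.1 < y.1]]]].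

(* For q = 1 the second clause asks about the symbol 0, which [low_descent]
   rejects. *)
Definition descent (q : nat) (T : filling) (i : nat) : bool :=
  low_descent q T i || (i == q) && low_descent q (KPro q T) q.-1.

End Defs.

(* Main.v *)
Require Import Defs.
From mathcomp Require Import all_boot.
From mathcomp Require Import zify.

(** K-promotion is a product of involutions, and descents can be followed
    through each factor.

    Write [bk k] for the K-Bender-Knuth involution: it exchanges the labels
    [k] and [k.+1] in the boxes labelled by one of them that have no neighbour
    labelled by the other.  Recording the empty boxes, just before label [j.+1]
    is processed, as boxes of level [j] turns each sliding step of K-promotion
    into one involution, so that K-promotion is [bk q.-1] o ... o [bk 1]
    ([KPro_promo]).

    Say that [k] is above [k.+1] when some [k] lies in a strictly higher row
    than some [k.+1].  The key fact ([above_shift]) is that [k] is above [k.+1]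
    in [bk k.+1 (bk k T)] if and only if [k.+1] is above [k.+2] in [T].  This is
    where the rectangular shape matters: when two boxes of the tableau differ
    in both coordinates, the other corners of the rectangle that they span are
    boxes too, and in the cases that arise their labels are forced.  Every
    other factor [bk j] of K-promotion leaves the relevant labels alone, which
    settles [1 < i < q] ([above_promo]).  For [i = q] the two sides agree by the definition of a
    descent.

    For [i = 1] one has to compare descents at [1] in [T] with descents at
    [q.-1] in the second K-promotion of [T].  Since distant involutions commute,
    the square of K-promotion is
      [bk 1], then [bk 2; bk 1], then [bk 3; bk 2], ..., then [bk q.-1]
    (in order of application).  By the key fact read backwards
    ([above_unshift]) each middle pair moves the descent up by one.  The
    first and the last factor preserve the descent: the label [1] occurs only in
    the northwest corner and [q] only in the southeast corner, so a descent at
    [1] or at [q.-1] comes from two adjacent boxes, which the involution fixes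
    ([above_bk_extreme]). *)

(** * Increasing fillings of a rectangle *)

Section KBenderKnuth.

Set Implicit Arguments.
Unset Strict Implicit.
Unset Printing Implicit Defensive.

Variables (a b : nat).
Implicit Types (T U : filling a b) (x y z : box a b) (k l m q : nat).

Definition northwest x y : bool := (x.1 <= y.1) && (x.2 <= y.2).

(** Strict monotonicity for the product order treats rows and columns at once;
    for fillings of a rectangle it amounts to increasing rows and columns. *)
Definition increasing T : Prop :=
  forall x y, northwest x y -> x != y -> T x < T y.

Lemma box_inj x y : x.1 = y.1 :> nat -> x.2 = y.2 :> nat -> x = y.
Proof.
by case: x y => [r c] [r' c'] /= /val_inj -> /val_inj ->.
Qed.

Lemma box_of (r c : nat) :
  r < a -> c < b -> exists x : box a b, x.1 = r :> nat /\ x.2 = c :> nat.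
Proof. by move=> ra cb; exists (Ordinal ra, Ordinal cb). Qed.

Lemma increasing_weak T x y : increasing T -> northwest x y -> T x <= T y.
Proof.
move=> incT nw; have [->//|ne] := eqVneq x y.
exact/ltnW/incT.
Qed.

Lemma tableau_increasing q T : increasing_tableau q T -> increasing T.
Proof.
move=> [_ rowT colT] [r c] [r' c'] /andP[/= ler lec] ne.
have [ltr|ger] := ltnP r r'.
  have [ltc|gec] := ltnP c c'.
    exact: ltn_trans (colT _ _ c ltr) (rowT _ _ _ ltc).
  have -> : c' = c by apply: val_inj => /=; lia.
  exact: colT.
have er : r' = r by apply: val_inj => /=; lia.
rewrite er in ne *; apply: rowT.
rewrite ltn_neqAle lec andbT; apply: contraNneq ne => ec.
by apply/eqP/box_inj.
Qed.

Lemma adjacent_coords x y :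
  adjacent x y <->
  x.1 = y.1 :> nat /\ (x.2.+1 = y.2 \/ y.2.+1 = x.2 :> nat) \/
  x.2 = y.2 :> nat /\ (x.1.+1 = y.1 \/ y.1.+1 = x.1 :> nat).
Proof.
by rewrite /adjacent -!val_eqE /=; lia.
Qed.

Lemma northwest_adjacent x y :
  adjacent x y ->
  (northwest x y \/ northwest y x) /\ x != y.
Proof.
move=> /adjacent_coords adj; rewrite /northwest; split; first by lia.
by apply/eqP => exy; move: adj; rewrite exy; lia.
Qed.

Lemma adjacent_sym x y : adjacent x y = adjacent y x.
Proof. by apply/idP/idP => /adjacent_coords ?; apply/adjacent_coords; lia. Qed.

Lemma adjacent_lt T x y :
  increasing T -> adjacent x y -> T x < T y -> northwest x y.
Proof.
move=> incT /northwest_adjacent [[//|nw] ne] lt.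
by move: (incT _ _ nw); rewrite eq_sym ne => /(_ isT); lia.
Qed.

Lemma adjacent_neq T x y : increasing T -> adjacent x y -> T x != T y.
Proof.
move=> incT /northwest_adjacent[[]nw ne].
  by rewrite neq_ltn incT.
by rewrite eq_sym in ne; rewrite neq_ltn (incT y x) ?orbT.
Qed.

(** Otherwise some third box lies between [x] and [y] in the product order, and
    there is no room for its label. *)
Lemma increasing_cover T x y :
  increasing T -> northwest x y -> T y = (T x).+1 -> adjacent x y.
Proof.
move=> incT nw eT; have xay := ltn_ord x.1; have xby := ltn_ord x.2.
have := ltn_ord y.1; have := ltn_ord y.2 => yb ya.
have step z : northwest x z -> x != z -> northwest z y -> z = y.
  move=> nxz ne nzy; apply/eqP/negP => /negP ne'.
  by have := incT _ _ nxz ne; have := incT _ _ nzy ne'; lia.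
move: (nw) => /andP[ler lec]; apply/adjacent_coords.
have [ltr|ger] := ltnP x.1 y.1.
  have [z [z1 z2]] := @box_of x.1.+1 x.2 ltac:(lia) ltac:(lia).
  have zy : z = y.
    apply: step; rewrite /northwest ?z1 ?z2; try lia.
    by apply/eqP => exz; move: z1; rewrite exz; lia.
  by rewrite -zy; lia.
have [ltc|gec] := ltnP x.2 y.2.
  have [z [z1 z2]] := @box_of x.1 x.2.+1 ltac:(lia) ltac:(lia).
  have zy : z = y.
    apply: step; rewrite /northwest ?z1 ?z2; try lia.
    by apply/eqP => exz; move: z2; rewrite exz; lia.
  by rewrite -zy; lia.
have exy : x = y by apply: box_inj; lia.
by move: eT; rewrite exy; lia.
Qed.

(** * K-Bender-Knuth involutions *)

Definition touches T x l : bool := [exists y, adjacent x y && (T y == l)].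

Lemma touchesP T x l :
  reflect (exists2 y : box a b, adjacent x y & T y = l) (touches T x l).
Proof.
apply: (iffP existsP) => [[y /andP[adj /eqP e]]|[y adj e]]; exists y => //.
by rewrite adj e eqxx.
Qed.

Definition bk k T : filling a b :=
  [ffun x => if (T x == k) && ~~ touches T x k.+1 then k.+1
             else if (T x == k.+1) && ~~ touches T x k then k
             else T x].

Lemma bk_low_stay k T x : T x = k -> touches T x k.+1 -> bk k T x = k.
Proof. by move=> e t; rewrite ffunE e eqxx t /= ltn_eqF. Qed.

Lemma bk_high_stay k T x : T x = k.+1 -> touches T x k -> bk k T x = k.+1.
Proof. by move=> e t; rewrite ffunE e eqxx t /= gtn_eqF. Qed.

Lemma bk_low_swap k T x : T x = k -> ~~ touches T x k.+1 -> bk k T x = k.+1.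
Proof. by move=> e t; rewrite ffunE e eqxx t. Qed.

Lemma bk_high_swap k T x : T x = k.+1 -> ~~ touches T x k -> bk k T x = k.
Proof. by move=> e t; rewrite ffunE e eqxx t gtn_eqF. Qed.

Lemma bk_other k T x : T x != k -> T x != k.+1 -> bk k T x = T x.
Proof. by move=> /negPf e /negPf e'; rewrite ffunE e e'. Qed.

(** The two indices are the labels of [x] before and after the involution. *)
Variant bk_spec k T x : nat -> nat -> Prop :=
  | BkLowStay y of adjacent x y & T y = k.+1 : bk_spec k T x k k
  | BkLowSwap of ~~ touches T x k.+1 : bk_spec k T x k k.+1
  | BkHighStay y of adjacent x y & T y = k : bk_spec k T x k.+1 k.+1
  | BkHighSwap of ~~ touches T x k : bk_spec k T x k.+1 k
  | BkOther v of v != k & v != k.+1 : bk_spec k T x v v.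

Lemma bkP k T x : bk_spec k T x (T x) (bk k T x).
Proof.
have [e|ne] := eqVneq (T x) k.
  have [t|t] := boolP (touches T x k.+1).
    by rewrite bk_low_stay // e; case/touchesP: t => y; apply: BkLowStay.
  by rewrite bk_low_swap // e; apply: BkLowSwap.
have [e|ne'] := eqVneq (T x) k.+1.
  have [t|t] := boolP (touches T x k).
    by rewrite bk_high_stay // e; case/touchesP: t => y; apply: BkHighStay.
  by rewrite bk_high_swap // e; apply: BkHighSwap.
by rewrite bk_other //; apply: BkOther.
Qed.

Lemma bk_level k T x l : l != k -> l != k.+1 -> (bk k T x == l) = (T x == l).
Proof. by move=> ? ?; case: bkP; lia. Qed.

Lemma bk_adjacent_stay k T x y :
  adjacent x y -> T x = k -> T y = k.+1 -> bk k T x = k /\ bk k T y = k.+1.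
Proof.
move=> adj ex ey; split.
  by apply: bk_low_stay => //; apply/touchesP; exists y.
by apply: bk_high_stay => //; apply/touchesP; exists x; rewrite // adjacent_sym.
Qed.

(** A label moves by at most one, so only a pair labelled [k], [k.+1] could
    cease to increase; such a pair is adjacent by [increasing_cover], hence
    fixed. *)
Lemma bk_increasing k T : increasing T -> increasing (bk k T).
Proof.
move=> incT x y nw ne; have lt := incT x y nw ne.
have [/andP[/eqP ex /eqP ey]|no] := boolP ((T x == k) && (T y == k.+1)).
  have adj : adjacent x y by apply: (increasing_cover incT); rewrite ?ex.
  by have [-> ->] := bk_adjacent_stay adj ex ey.
by move: lt no; case: (bkP k T x) => [? ? ?|?|? ? ?|?|? ? ?]; case: (bkP k T y); lia.
Qed.

Lemma touches_bk k T x l :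
  l != k -> l != k.+1 -> touches (bk k T) x l = touches T x l.
Proof.
by move=> nk nk1; apply: eq_existsb => y; rewrite bk_level.
Qed.

(** Isolated boxes stay isolated because adjacent boxes never share a label: a
    neighbour can receive the old label of [x] only by carrying the new label
    of [x] or by having carried the old one. *)
Lemma bk_involutive k T : increasing T -> bk k (bk k T) = T.
Proof.
move=> incT; apply/ffunP => x.
have stay y : adjacent x y -> T x = k -> T y = k.+1 -> bk k (bk k T) x = k.
  move=> adj ex ey; have [e1 e2] := bk_adjacent_stay adj ex ey.
  by have [] := bk_adjacent_stay adj e1 e2.
have stay' y : adjacent x y -> T x = k.+1 -> T y = k -> bk k (bk k T) x = k.+1.
  rewrite adjacent_sym => adj ex ey; have [e1 e2] := bk_adjacent_stay adj ey ex.
  by have [] := bk_adjacent_stay adj e1 e2.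
have isolated l m : T x = l -> ~~ touches T x m -> bk k T x = m ->
    [\/ l = k /\ m = k.+1 | l = k.+1 /\ m = k] -> ~~ touches (bk k T) x l.
  move=> ex tx em lm; apply/touchesP => -[y adj]; have := adjacent_neq incT adj.
  have : T y != m by apply: contraNneq tx => ey; apply/touchesP; exists y.
  by case: bkP; lia.
move: (bkP k T x); move Eu: (T x) => u; move Ev: (bk k T x) => v spec.
case: spec Eu Ev => [y adj ey|t|y adj ey|t|w nk nk1] ex e.
- exact: stay adj ex ey.
- by apply: bk_high_swap => //; apply: (isolated _ k.+1) => //; left.
- exact: stay' adj ex ey.
- by apply: bk_low_swap => //; apply: (isolated _ k) => //; right.
- by rewrite bk_other ?e.
Qed.

Lemma bk_comm j k T : j.+1 < k -> bk j (bk k T) = bk k (bk j T).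
Proof.
move=> jk; apply/ffunP => x.
rewrite ffunE !bk_level ?touches_bk; try lia.
rewrite [RHS]ffunE !bk_level ?touches_bk; try lia.
rewrite !ffunE; do ![case: eqP => //= ?]; try lia; by case: ifP.
Qed.

(** * Descents under two consecutive involutions *)

Definition above T k : bool :=
  [exists x : box a b, [exists y : box a b,
     [&& T x == k, T y == k.+1 & x.1 < y.1]]].

Lemma aboveP T k :
  reflect (exists x y : box a b, [/\ T x = k, T y = k.+1 & x.1 < y.1]) (above T k).
Proof.
apply: (iffP existsP) => [[x /existsP[y /and3P[/eqP ex /eqP ey lt]]]|].
  by exists x, y.
move=> [x [y [ex ey lt]]]; exists x; apply/existsP; exists y.
by rewrite ex ey lt !eqxx.
Qed.

Lemma above_bk_other k l T :
  (l.+1 < k) || (k.+1 < l) -> above (bk k T) l = above T l.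
Proof.
by move=> kl; do 2 apply: eq_existsb => ?; rewrite !bk_level //; lia.
Qed.

Lemma bk_touching_low k T x :
  T x = k.+1 -> increasing T -> exists2 z : box a b, bk k T z = k & z.1 <= x.1.
Proof.
move=> ex incT; have [/touchesP[z adj ez]|t] := boolP (touches T x k).
  exists z; first by rewrite adjacent_sym in adj; have [] := bk_adjacent_stay adj ez ex.
  rewrite adjacent_sym in adj.
  suff /andP[] : northwest z x by [].
  by apply: (adjacent_lt incT adj); rewrite ex ez.
by exists x; rewrite // bk_high_swap.
Qed.

(** Let [x] carry [k.+1] above [y] carrying [k.+2] in [T], and put
    [U := bk k T].  Some box [x'] weakly above [x] ends with [k], and [y] ends
    with [k.+1] unless it has a neighbour [z] with [U z = k.+1], in which case
    [z] ends with [k.+1].  The only delicate situation is that [z] sits directly above [y] in the row of [x];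
    there the label of [z] in [T], and then that of a corner of the rectangle,
    are forced. *)
Lemma above_shift_fwd k T :
  increasing T -> above T k.+1 -> above (bk k.+1 (bk k T)) k.
Proof.
move=> incT /aboveP[x [y [ex ey lt]]].
set U := bk k T; set V := bk k.+1 U.
have incU : increasing U := @bk_increasing k _ incT.
have UV z : U z = k -> V z = k by move=> ez; rewrite /V bk_other ez //; lia.
have [x' ex' lex'] := bk_touching_low ex incT.
have eUy : U y = k.+2 by rewrite /U bk_other ey //; lia.
have [/touchesP[z adj ez]|t] := boolP (touches U y k.+1); last first.
  apply/aboveP; exists x', y; split; [exact: UV | exact: bk_high_swap|lia].
rewrite adjacent_sym in adj.
have [eVz _] := bk_adjacent_stay adj ez eUy.
have /andP[le1 le2] : northwest z y by apply: (adjacent_lt incU adj); rewrite ez eUy.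
have [ltz|gez] := ltnP x'.1 z.1.
  by apply/aboveP; exists x', z; split => //; exact: UV.
have {le1 le2} [z1 [y1 y2]] :
    z.1 = x.1 :> nat /\ (y.1 = x.1.+1 :> nat /\ z.2 = y.2 :> nat).
  by move/adjacent_coords: adj; lia.
have z_cases : (T z = k.+1 /\ exists2 w : box a b, adjacent z w & T w = k) \/
               (T z = k /\ ~~ touches T z k.+1).
  by move: ez; rewrite /U; case: bkP => [||w ? ? _|//|*];
    [lia|by right|left; split=> //; exists w|lia|lia].
case: z_cases => [[eTz [w adjw ew]]|[eTz t]]; last first.
  (* In the row of [z], where [T z = k], the label [k.+1] of [x] must be next to
     it. *)
  case/negP: t; apply/touchesP; exists x => //.
  apply: (increasing_cover incT); last by rewrite ex eTz.
  have [le|gt] := leqP z.2 x.2; first by rewrite /northwest z1 leqnn.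
  have := incT x z; rewrite /northwest ex eTz; suff : x != z by lia.
  by apply/eqP => exz; move: gt; rewrite exz; lia.
have eUw : U w = k.
  by rewrite adjacent_sym in adjw; have [] := bk_adjacent_stay adjw ew eTz.
rewrite adjacent_sym in adjw.
have /andP[lew1 lew2] : northwest w z by apply: (adjacent_lt incT adjw); lia.
have [ltw|gew] := ltnP w.1 z.1.
  by apply/aboveP; exists w, z; split => //; exact: UV.
have ltw2 : w.2.+1 = z.2 by move/adjacent_coords: adjw; lia.
have yb := ltn_ord w.2; have ya := ltn_ord y.1.
(* Now [w], [z], [y] form the corner [k  k.+1] over [k.+2]; the box [v] below [w]
   and left of [y] must then carry [k.+1], in all three tableaux. *)
have [v [v1 v2]] := @box_of y.1 w.2 ya yb.
have ewv : adjacent w v by apply/adjacent_coords; lia.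
have evy : adjacent v y by apply/adjacent_coords; lia.
have eTv : T v = k.+1.
  have : northwest w v by rewrite /northwest; lia.
  move=> /incT; have [_ ->] := northwest_adjacent ewv => /(_ isT).
  have : northwest v y by rewrite /northwest; lia.
  move=> /incT; have [_ ->] := northwest_adjacent evy => /(_ isT).
  by lia.
have [_ eUv] := bk_adjacent_stay ewv ew eTv.
have [eVv _] := bk_adjacent_stay evy eUv eUy.
by apply/aboveP; exists w, v; split; [exact: UV|exact: eVv|lia].
Qed.

(** Let [x] end with [k] above some [y] ending with [k.+1]; a box [w] weakly
    below [y] carries [k.+2] in [T].  If [T x = k.+1], then [x] and [w] form a
    descent of [T].  Otherwise [x] touches some [z] with [T z = k.+1] to its right or below; the
    delicate case is [z] directly below [x] and in the same row as the label
    [k.+2] of [w], where the box right of [x] must carry [k.+1]. *)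
Lemma above_shift_bwd k T :
  increasing T -> above (bk k.+1 (bk k T)) k -> above T k.+1.
Proof.
set U := bk k T; set V := bk k.+1 U => incT /aboveP[x [y [ex ey lt]]].
have incU : increasing U := @bk_increasing k _ incT.
have UC z : U z = k.+2 -> T z = k.+2 by rewrite /U; case: bkP; lia.
have [w ew lew] : exists2 w : box a b, T w = k.+2 & y.1 <= w.1.
  move: ey; rewrite /V.
  move: (bkP k.+1 U y); move Eu: (U y) => u spec.
  case: spec Eu => [w adj ew|?|? ? ?|?|v ? ?] eUy; try lia.
    exists w; first exact: UC.
    suff /andP[] : northwest y w by [].
    by apply: (adjacent_lt incU adj); rewrite ew; lia.
  by exists y => //; exact: UC.
have {ex} : U x = k by move: ex; rewrite /V; case: bkP; lia.
rewrite {1}/U; move: (bkP k T x); move Eu: (T x) => u spec.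
case: spec Eu => [z adj ez|?|? ? ?|?|v ? ?] ex; try lia; last first.
  by move=> _; apply/aboveP; exists x, w; split => //; lia.
move=> _; have /andP[lez1 lez2] : northwest x z by apply: (adjacent_lt incT adj); lia.
have [ltz|gez] := ltnP z.1 w.1.
  by apply/aboveP; exists z, w; split.
have [z1 [z2 w1]] : z.1 = x.1.+1 :> nat /\ (z.2 = x.2 :> nat /\ w.1 = z.1 :> nat).
  by move/adjacent_coords: adj; lia.
have ltw2 : z.2 < w.2.
  rewrite ltnNge; apply/negP => le; have := @increasing_weak T w z incT.
  by rewrite /northwest; lia.
have wb := ltn_ord w.2.
have xa := ltn_ord x.1.
have [m [m1 m2]] := @box_of x.1 x.2.+1 ltac:(lia) ltac:(lia).
have eTm : T m = k.+1.
  have xm : x != m by apply/eqP => exm; move: m2; rewrite exm; lia.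
  have mw : m != w by apply/eqP => emw; move: m1; rewrite emw; lia.
  have := incT x m; have := incT m w; rewrite /northwest xm mw; lia.
by apply/aboveP; exists m, w; split => //; lia.
Qed.

Lemma above_shift k T :
  increasing T -> above (bk k.+1 (bk k T)) k = above T k.+1.
Proof.
move=> incT; apply/idP/idP; [exact: above_shift_bwd|exact: above_shift_fwd].
Qed.

Lemma above_unshift k T :
  increasing T -> above (bk k (bk k.+1 T)) k.+1 = above T k.
Proof.
move=> incT; have incU := @bk_increasing k.+1 _ incT.
rewrite -above_shift; last exact: bk_increasing.
by rewrite !bk_involutive.
Qed.

(** * Descents at the two extreme labels *)

Definition bounded q T : Prop := forall x, 0 < T x <= q.

Lemma bk_bounded q k T : 0 < k < q -> bounded q T -> bounded q (bk k T).
Proof. by move=> kq bT x; move: (bT x); case: bkP; lia. Qed.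

(** A smallest label sits in the northwest corner and a largest one in the
    southeast corner, and these are comparable to every box. *)
Lemma extreme_northwest q k T x y :
  increasing T -> bounded q T -> (k == 1) || (k.+1 == q) ->
  T x = k -> T y = k.+1 -> northwest x y.
Proof.
move=> incT bT kq ex ey; have xa := ltn_ord x.1; have xb := ltn_ord x.2.
case/orP: kq => /eqP ek.
  have [o [o1 o2]] := @box_of 0 0 ltac:(lia) ltac:(lia).
  have -> : x = o.
    apply/eqP/negP => /negP; rewrite eq_sym => ne.
    have := incT o x; rewrite /northwest o1 o2 => /(_ isT ne).
    by have := bT o; lia.
  by rewrite /northwest o1 o2.
have [o [o1 o2]] := @box_of a.-1 b.-1 ltac:(lia) ltac:(lia).
have top z : northwest z o.
  by have := ltn_ord z.1; have := ltn_ord z.2; rewrite /northwest; lia.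
have -> // : y = o.
apply/eqP/negP => /negP ne; have := incT y o (top y) ne.
by have := bT o; lia.
Qed.

Lemma above_bk_extreme q k T :
  increasing T -> bounded q T -> 0 < k < q -> (k == 1) || (k.+1 == q) ->
  above (bk k T) k = above T k.
Proof.
move=> incT bT kq ext.
have fwd U : increasing U -> bounded q U -> above U k -> above (bk k U) k.
  move=> incU bU /aboveP[x [y [ex ey lt]]].
  have nw := extreme_northwest incU bU ext ex ey.
  have adj : adjacent x y by apply: (increasing_cover incU nw); rewrite ex.
  have [ex' ey'] := bk_adjacent_stay adj ex ey.
  by apply/aboveP; exists x, y.
apply/idP/idP => [ab|]; last exact: fwd.
rewrite -(bk_involutive k incT); apply: fwd ab; first exact: bk_increasing.
exact: bk_bounded.
Qed.

(** * Descents under products of involutions *)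

Fixpoint promo m T : filling a b := if m is m'.+1 then bk m (promo m' T) else T.

Lemma promo_increasing m T : increasing T -> increasing (promo m T).
Proof. by move=> incT; elim: m => //= m; exact: bk_increasing. Qed.

Lemma promo_bounded q m T : m < q -> bounded q T -> bounded q (promo m T).
Proof.
move=> mq bT; elim: m mq => //= m IHm mq.
by apply: bk_bounded => //; apply: IHm; lia.
Qed.

Lemma above_promo_below m l T : m.+1 < l -> above (promo m T) l = above T l.
Proof.
by elim: m => //= m IHm ml; rewrite above_bk_other ?IHm //; lia.
Qed.

Lemma above_promo_after m l T :
  l < m -> above (promo m T) l = above (promo l.+1 T) l.
Proof.
elim: m => // m IHm; rewrite ltnS leq_eqVlt => /predU1P[-> //|lm].
by rewrite [promo m.+1 T]/= above_bk_other ?IHm //; lia.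
Qed.

(** Of the factors of [promo m], only [bk l] and [bk l.+1] carry the descent
    from [l.+1] to [l]; the earlier ones do not touch [l.+1], [l.+2], and the
    later ones do not touch [l], [l.+1]. *)
Lemma above_promo m l T :
  increasing T -> 0 < l < m -> above (promo m T) l = above T l.+1.
Proof.
case: l => // l incT lm; rewrite above_promo_after //=.
rewrite above_shift ?above_promo_below //.
exact: promo_increasing.
Qed.

Lemma bk_promo_comm m k T : m.+1 < k -> bk k (promo m T) = promo m (bk k T).
Proof.
by elim: m => //= m IHm mk; rewrite -bk_comm ?IHm //; lia.
Qed.

(** By commutation, [promo m.+1 o promo m.+2] is [promo m o promo m.+1] followed
    by [bk m.+2] and [bk m.+1], and [above_unshift] applies to that last pair;
    the induction starts with the single factor [bk 1]. *)
Lemma above_promo_twice m T q :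
  increasing T -> bounded q T -> m.+1 < q ->
  above (promo m (promo m.+1 T)) m.+1 = above T 1.
Proof.
move=> incT bT; elim: m => [|m IHm] mq; first by apply: (above_bk_extreme incT bT); lia.
rewrite -IHm; last by lia.
have -> : promo m.+1 (promo m.+2 T) =
          bk m.+1 (bk m.+2 (promo m (promo m.+1 T))) by rewrite bk_promo_comm.
rewrite above_unshift //.
by do 2 apply: promo_increasing.
Qed.

Lemma above_promo2 q T :
  increasing T -> bounded q T -> 1 < q ->
  above (promo q.-1 (promo q.-1 T)) q.-1 = above T 1.
Proof.
case: q => [|[|m]] //= incT bT _.
have inc1 : increasing (promo m.+1 T) by exact: promo_increasing.
rewrite -(@above_promo_twice m _ m.+2) //.
apply: (@above_bk_extreme m.+2) => //; last by rewrite eqxx orbT.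
- exact: promo_increasing.
- by apply: promo_bounded; [lia | apply: (@promo_bounded _ m.+1)].
- by lia.
Qed.

(** * Sliding steps as involutions *)

Lemma component_nontrivial (S : {set box a b}) x :
  x \in S ->
  (1 < #|component S x|) = [exists y, adjacent x y && (y \in S)].
Proof.
move=> xS; set e := fun u v => [&& u \in S, v \in S & adjacent u v].
have xx : x \in component S x by rewrite inE connect0.
apply/idP/existsP => [|[y /andP[adj yS]]].
  rewrite (cardD1 x) xx ltnS => /card_gt0P[z]; rewrite !inE => /andP[zx].
  case/connectP => -[|y p] /=; first by move=> _ ez; rewrite ez eqxx in zx.
  by case/andP=> /and3P[_ yS adj] _ _; exists y; rewrite adj.
have [_ ne] := northwest_adjacent adj.
apply: leq_trans (_ : #|[set x; y]| <= _); first by rewrite cards2 ne.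
apply/subset_leq_card/subsetP => z /set2P[] -> //.
by rewrite inE connect1 // xS yS adj.
Qed.

(** The state of K-promotion of which [T] is the level filling: boxes of level
    [j] are empty, and the boxes of lower level already hold their final label,
    larger by one than it will be after the closing subtraction. *)
Definition mid_promo j T : partial_filling a b :=
  [ffun x => if T x < j then Some (T x).+1
             else if T x == j then None else Some (T x)].

Lemma active_mid_promo j T x :
  (x \in active j.+1 (mid_promo j T)) = (T x == j) || (T x == j.+1).
Proof.
rewrite inE ffunE; case: (ltngtP (T x) j) => //= lt.
by rewrite [LHS](_ : _ = ((T x).+1 == j.+1)) //; lia.
Qed.

Lemma mid_promoE j T x :
  mid_promo j T x = if T x < j then Some (T x).+1
                    else if T x == j then None else Some (T x).
Proof. by rewrite ffunE. Qed.

Lemma swap_stepE (F : partial_filling a b) i x (t : bool) :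
  (x \in active i F -> [exists y, adjacent x y && (y \in active i F)] = t) ->
  swap_step F i x =
  if (x \in active i F) && t then (if F x == None then Some i else None)
  else F x.
Proof.
move=> et; rewrite ffunE; have [act|//] := boolP (x \in active i F).
congr (if _ then _ else _); rewrite -(et act); exact: component_nontrivial.
Qed.

(** Exchanging empty boxes with labels [j.+1] in a large component keeps every
    level, since the level of empty boxes rises from [j] to [j.+1] at the same
    time.  For the same reason it is the untouched one-box components that
    change level, as in [bk j]. *)
Lemma swap_step_mid_promo j T :
  increasing T -> swap_step (mid_promo j T) j.+1 = mid_promo j.+1 (bk j T).
Proof.
move=> incT; suff eqx x : swap_step (mid_promo j T) j.+1 x =
  mid_promo j.+1 (bk j T) x by apply/ffunP.
rewrite (@swap_stepE _ _ _ (touches T x (if T x == j then j.+1 else j))); last first.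
  rewrite active_mid_promo => act.
  apply: eq_existsb => y; apply: andb_id2l => adj; rewrite active_mid_promo.
  by have := adjacent_neq incT adj; case: ifP act; lia.
rewrite active_mid_promo !mid_promoE.
have [act|/norP[n1 n2]] := boolP ((T x == j) || (T x == j.+1)); last first.
  by rewrite bk_other //= (negPf n1) (negPf n2) ltnS (leq_eqVlt (T x) j) (negPf n1).
have [ej|nj] := eqVneq (T x) j.
  have [t|t] := boolP (touches T x j.+1).
    by rewrite bk_low_stay // ej ltnn ltnSn.
  by rewrite bk_low_swap // ej ltnn ltnn eqxx.
have ej : T x = j.+1 by move: act nj; lia.
have lt : (j.+1 < j) = false by lia.
have [t|t] := boolP (touches T x j).
  by rewrite bk_high_stay // ej lt ltnn eqxx.
by rewrite bk_high_swap // ej lt ltnSn.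
Qed.

Lemma foldl_swap_step m T :
  increasing T -> (forall x, 0 < T x) ->
  foldl (@swap_step a b) (delete_ones T) (index_iota 2 m.+2) =
  mid_promo m.+1 (promo m T).
Proof.
move=> incT T_gt0; elim: m => [|m IHm].
  by apply/ffunP => x; rewrite !ffunE /= ltnS leqn0 eqn0Ngt T_gt0.
have -> : index_iota 2 m.+3 = rcons (index_iota 2 m.+2) m.+2.
  by rewrite /index_iota (_ : m.+3 - 2 = m.+2 - 2 + 1) ?iotaD ?cats1 /=;
    [congr rcons|lia]; lia.
rewrite foldl_rcons IHm swap_step_mid_promo //.
exact: promo_increasing.
Qed.

Lemma KPro_promo q T :
  0 < q -> increasing T -> bounded q T -> KPro q T = promo q.-1 T.
Proof.
case: q => // m _ incT bT; apply/ffunP => x; rewrite ffunE foldl_swap_step //; last first.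
  by move=> y; case/andP: (bT y).
have /andP[_] := promo_bounded (ltnSn m) bT x.
by rewrite ffunE /=; case: ltngtP.
Qed.

End KBenderKnuth.

(** * Descents rotate under K-promotion *)

Theorem proposition2p8 (a b q : nat) (ha : 1 <= a) (hb : 1 <= b) (hq : 1 <= q)
    (T : filling a b) (hT : increasing_tableau q T)
    (i : nat) (hi : 1 <= i <= q) :
  descent q T i <-> descent q (KPro q T) (if i == 1 then q else i.-1).
Proof.
have incT := tableau_increasing hT.
have bT : bounded q T by case: hT.
have bP : bounded q (promo q.-1 T) by apply: promo_bounded => //; lia.
have incP : increasing (promo q.-1 T) by exact: promo_increasing.
have low U l : low_descent q U l = [&& 0 < l, l < q & above U l] by [].
rewrite /descent (KPro_promo hq incT bT) (KPro_promo hq incP bP) !low.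
have [i1|i_neq1] := eqVneq i 1.
  have [q1|q_gt1] := leqP q 1; first by lia.
  by rewrite i1 above_promo2 //; lia.
have [iq|qi] := ltnP i q; last first.
  have eiq : i = q by lia.
  by rewrite eiq in hi i_neq1 *; lia.
have shift : above (promo q.-1 T) i.-1 = above T i.
  by rewrite above_promo ?prednK //; lia.
by rewrite shift; lia.
Qed.
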